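(* Let $G=(V,E)$ be a finite graph and $m\ge 2$. Then $\mathrm{c\text{-}rk}\,G\ge m$ if and only if there exist $v,w\in V$ such that $\mathrm{St}(v)\neq\mathrm{St}(w)$ and $\mathrm{c\text{-}rk}_{G-\{v,w\}}(\mathrm{St}(v)\cap\mathrm{St}(w))\ge m-2$.
   Context: Graphs are finite, undirected, without loops or multiple edges. $\mathrm{St}(v)$ is the set of vertices adjacent to $v$. For a graph $H=(U,F)$, $A_H^c$ is the $U\times U$ boolean matrix with $(i,j)$ entry $0$ if $\{i,j\}\in F$ and $1$ otherwise. Over the superboolean semiring $\mathbb{SB}=\{0,1,1^\nu\}$ (addition $0+x=x$, $1+1=1^\nu$, $1^\nu+x=1^\nu$; multiplication $0\cdot x=0$, $1\cdot1=1$, $1\cdot1^\nu=1^\nu\cdot1^\nu=1^\nu$), vectors $C_1,\dots,C_k$ are dependent if some $\sum\lambda_iC_i$ with $\lambda_i\in\{0,1\}$ not all zero has all coordinates in $\{0,1^\nu\}$, and independent otherwise. For $J\subseteq U$, $\mathrm{c\text{-}rk}_H J$ is the maximum number of independent columns of $A^c_H$ among those indexed by $J$ (the rank of $A_H^c[U,J]$), and $\mathrm{c\text{-}rk}\,H=\mathrm{c\text{-}rk}_H U$. For $X\subseteq V$, $G-X$ is the graph obtained from $G$ by deleting the vertices of $X$ and all edges incident to them. *)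

(* Defs.v *)
From HB Require Import structures.
From mathcomp Require Import all_boot all_order all_algebra.
Set Implicit Arguments.
Unset Strict Implicit.
Unset Printing Implicit Defensive.
Import GRing.Theory.

(* The superboolean semiring {0, 1, 1^nu}; [SBnu] is the ghost element 1^nu. *)
Inductive superbool : Type := SB0 | SB1 | SBnu.

Definition sb_code (x : superbool) : option bool :=
  match x with SB0 => None | SB1 => Some true | SBnu => Some false end.
Definition sb_decode (c : option bool) : superbool :=
  match c with None => SB0 | Some true => SB1 | Some false => SBnu end.
Lemma sb_codeK : cancel sb_code sb_decode. Proof. by case. Qed.
HB.instance Definition _ := Finite.copy superbool (can_type sb_codeK).

Definition sb_add (x y : superbool) : superbool :=
  match x, y with
  | SB0, z | z, SB0 => z
  | _, _ => SBnu
  end.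
Definition sb_mul (x y : superbool) : superbool :=
  match x, y with
  | SB0, _ | _, SB0 => SB0
  | SB1, SB1 => SB1
  | _, _ => SBnu
  end.

Lemma sb_addA : associative sb_add. Proof. by do 3!case. Qed.
Lemma sb_addC : commutative sb_add. Proof. by do 2!case. Qed.
Lemma sb_add0 : left_id SB0 sb_add. Proof. by case. Qed.
HB.instance Definition _ :=
  GRing.isNmodule.Build superbool sb_addA sb_addC sb_add0.

Lemma sb_mulA : associative sb_mul. Proof. by do 3!case. Qed.
Lemma sb_mulC : commutative sb_mul. Proof. by do 2!case. Qed.
Lemma sb_mul1 : left_id SB1 sb_mul. Proof. by case. Qed.
Lemma sb_mulDl : left_distributive sb_mul sb_add. Proof. by do 3!case. Qed.
Lemma sb_mul0 : left_zero SB0 sb_mul. Proof. by case. Qed.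
Lemma sb_1neq0 : SB1 != SB0. Proof. by []. Qed.
HB.instance Definition _ := GRing.Nmodule_isComNzSemiRing.Build superbool
  sb_mulA sb_mulC sb_mul1 sb_mulDl sb_mul0 sb_1neq0.

(* [C i r] is coordinate [r] of the vector [C i].  The vectors are taken as a
   family indexed by [K], so two equal vectors with distinct indices are
   dependent (1 + 1 = 1^nu). *)
Definition sb_dependent (I R : finType) (C : I -> R -> superbool)
    (K : {set I}) : bool :=
  [exists lam : {ffun I -> superbool},
    [&& [forall i in K, lam i \in [:: 0; 1]],
        [exists i in K, lam i != 0]
      & [forall r, \sum_(i in K) lam i * C i r \in [:: 0; SBnu]]]]%R.

Definition sb_independent (I R : finType) (C : I -> R -> superbool)
    (K : {set I}) : bool := ~~ sb_dependent C K.

Record sgraph := SGraph {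
  vertex :> finType;
  adj : rel vertex;
  adj_sym : symmetric adj;
  adj_irrefl : irreflexive adj
}.

Definition St (G : sgraph) (v : G) : {set G} := [set w | adj v w].

(* The matrix A^c_H, entry in row [i] and column [j]. *)
Definition compl_mx (H : sgraph) (i j : H) : superbool :=
  (if adj i j then 0 else 1)%R.
Definition compl_col (H : sgraph) (j : H) : H -> superbool :=
  fun i => compl_mx i j.

Definition crk_on (H : sgraph) (J : {set H}) : nat :=
  \max_(K : {set H} | (K \subset J) && sb_independent (@compl_col H) K) #|K|.

Definition crk (H : sgraph) : nat := crk_on [set: H].

Section Deletion.
Variables (G : sgraph) (X : {set G}).

Definition del_adj : rel {x : G | x \notin X} :=
  fun x y => adj (val x) (val y).
Lemma del_adj_sym : symmetric del_adj.
Proof. by move=> x y; apply: adj_sym. Qed.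
Lemma del_adj_irrefl : irreflexive del_adj.
Proof. by move=> x; apply: adj_irrefl. Qed.

Definition del : sgraph := SGraph del_adj_sym del_adj_irrefl.

(* A set of vertices of [G] seen inside [G - X]; faithful when it is disjoint
   from [X]. *)
Definition del_set (J : {set G}) : {set del} :=
  [set x : {x : G | x \notin X} | val x \in J].

End Deletion.

(* Main.v *)
Require Import Defs.
From mathcomp Require Import all_boot all_order all_algebra.

(** In [A^c_G], row [r] has its 1s in [K] exactly at the columns of
    [K :\: St r].  So [K] is independent iff every nonempty subset [S] of it is
    hit exactly once by some row, i.e. [#|S :\: St r| = 1]; peeling off the hit
    columns one at a time amounts to a chain of intersections of neighbourhoods.
    The first two rows [v], [w] used to peel an independent set leave an
    independent subset of [St v :&: St w], on which these two rows vanish and are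
    therefore useless.  Conversely, if [x] lies in [St v] but not in [St w], then
    adding the columns [v] and [x] to an independent subset of [St v :&: St w]
    keeps it independent: row [v] peels off [v], then row [w] peels off [x]. *)

Import GRing.Theory.

(** From the second summand on, a sum of 1s stays at [SBnu]. *)
Lemma superbool_natr_ghost (n : nat) :
  ((n%:R : superbool) \in [:: 0; SBnu])%R = (n != 1).
Proof. by case: n => [|[|n]] //; rewrite !mulrS; case: (n%:R : superbool)%R. Qed.

Lemma sum_superbool_indicator (I : finType) (A S : {set I})
    (F : I -> superbool) : S \subset A ->
  (forall i, i \in A -> F i = if i \in S then 1 else 0)%R ->
  (\sum_(i in A) F i = #|S|%:R)%R.
Proof.
move=> sSA FE; rewrite (eq_bigr _ FE) -big_mkcondr /= -sumr_const.
apply: eq_bigl => i; case iS: (i \in S); last by rewrite andbF.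
by rewrite (subsetP sSA).
Qed.

(** Coefficients in {0, 1} are the indicator of their support [S]. Coordinate [r] of the combination
    is then a sum of [#|S :\: St r|] ones, which avoids 0 and [SBnu] only when this count is 1. *)
Lemma sb_independentP (H : sgraph) (K : {set H}) :
  reflect (forall S : {set H}, S \subset K -> S != set0 ->
             exists r : H, #|S :\: St r| == 1)
          (sb_independent (@compl_col H) K).
Proof.
apply: (iffP idP) => [Kind S sSK S0 | hit].
  apply/existsP; apply: contraNT Kind; rewrite negb_exists => /forallP miss.
  apply/existsP; exists [ffun i => if i \in S then 1 else 0]%R.
  apply/and3P; split.
  - by apply/forall_inP => i _; rewrite ffunE !inE; case: ifP.
  - case/set0Pn: S0 => i iS; apply/exists_inP; exists i; last by rewrite ffunE iS.
    exact: (subsetP sSK).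
  - apply/forallP => r.
    rewrite (@sum_superbool_indicator _ _ (S :\: St r)) ?superbool_natr_ghost //.
      exact: subset_trans (subsetDl _ _) sSK.
    move=> i _; rewrite ffunE !inE /compl_col /compl_mx.
    by case: (adj r i); case: (i \in S).
apply/existsP => -[lam /and3P[/forall_inP lam01 /exists_inP[i0 i0K lam0]]].
move=> /forallP ghost.
have sSK : [set i in K | lam i != 0%R] \subset K.
  by apply/subsetP => i; rewrite inE => /andP[].
have [|r] := hit _ sSK; first by apply/set0Pn; exists i0; rewrite inE i0K.
apply/negP; rewrite -superbool_natr_ghost; have := ghost r.
rewrite (@sum_superbool_indicator _ _ ([set i in K | lam i != 0%R] :\: St r)) //.
  exact: subset_trans (subsetDl _ _) sSK.
move=> i iK; have := lam01 i iK; rewrite !inE iK /compl_col /compl_mx.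
by case/orP=> /eqP ->; case: (adj r i).
Qed.

Lemma leq_crk_on (H : sgraph) (J : {set H}) (n : nat) :
  reflect (exists K : {set H},
             [/\ K \subset J, sb_independent (@compl_col H) K & n <= #|K|])
          (n <= crk_on J).
Proof.
apply: (iffP idP) => [|[K [sKJ Kind nK]]]; last first.
  apply: leq_trans nK _.
  by apply: (@leq_bigmax_cond _ _ (fun K : {set H} => #|K|)); rewrite sKJ.
rewrite /crk_on => nJ.
(* The maximum is attained only over a nonempty family; [set0] is a member. *)
have indep0 : sb_independent (@compl_col H) set0.
  by apply/sb_independentP => S; rewrite subset0 => ->.
have [|K /andP[sKJ Kind] Kmax] := @eq_bigmax_cond _
  [pred K : {set H} | (K \subset J) && sb_independent (@compl_col H) K]
  (fun K : {set H} => #|K|).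
  by apply/card_gt0P; exists set0; rewrite inE sub0set.
by exists K; split=> //; rewrite -Kmax.
Qed.

Lemma sb_independentS (H : sgraph) (K L : {set H}) : L \subset K ->
  sb_independent (@compl_col H) K -> sb_independent (@compl_col H) L.
Proof.
move=> sLK /sb_independentP Kind; apply/sb_independentP => S sSL.
exact/Kind/(subset_trans sSL).
Qed.

(** Row [v] is 0 on [K] and 1 at [x], so it hits exactly once every subset containing [x]; the other
    subsets lie in [K]. *)
Lemma sb_independentU1 (H : sgraph) (K : {set H}) (v x : H) :
    ~~ adj v x -> K \subset St v -> sb_independent (@compl_col H) K ->
  sb_independent (@compl_col H) (x |: K).
Proof.
move=> nvx sKv /sb_independentP Kind; apply/sb_independentP => S sSxK S0.
have [xS | xS] := boolP (x \in S); last first.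
  apply: Kind S0; apply/subsetP => y yS; have := subsetP sSxK y yS.
  by case/setU1P => // yx; rewrite -yx yS in xS.
exists v; apply/cards1P; exists x; apply/setP => y; rewrite !inE.
apply/andP/eqP => [[nvy yS] | -> //].
case/setU1P: (subsetP sSxK y yS) => // /(subsetP sKv).
by rewrite inE (negPf nvy).
Qed.

Lemma sb_independent_peel (H : sgraph) (K : {set H}) :
    sb_independent (@compl_col H) K -> K != set0 ->
  exists v x : H, [/\ x \in K, ~~ adj v x & K :\ x \subset St v].
Proof.
move=> /sb_independentP Kind /(Kind K (subxx K))[v /cards1P[x KvE]].
have: x \in K :\: St v by rewrite KvE set11.
rewrite !inE => /andP[nvx xK]; exists v, x; split=> //.
by rewrite -KvE setDDr setDv set0U subsetIr.
Qed.

Lemma card_del_hits (G : sgraph) (X : {set G}) (S : {set del X}) (r : del X) :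
  #|S :\: St r| = #|(val @: S) :\: St (val r)|.
Proof.
rewrite -(card_imset _ (@val_inj _ _ {x : G | x \notin X})).
congr #|pred_of_set _|; apply/setP => y; apply/imsetP/setDP.
  case=> x /setDP[xS]; rewrite inE => nrx ->.
  by rewrite imset_f // inE.
case=> /imsetP[x xS ->]; rewrite inE => nrx.
by exists x; rewrite // !inE xS andbT.
Qed.

(** The deleted rows vanish on [K], so a row hitting a nonempty subset exactly once is never among
    them. *)
Lemma sb_independent_del_set (G : sgraph) (X K : {set G}) :
    (forall x, x \in X -> K \subset St x) ->
    sb_independent (@compl_col G) K ->
  sb_independent (@compl_col (del X)) (del_set X K).
Proof.
move=> sKX /sb_independentP Kind; apply/sb_independentP => S sSK S0.
have sSK' : val @: S \subset K.
  apply/subsetP => _ /imsetP[x xS ->].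
  by have := subsetP sSK x xS; rewrite inE.
have [|r hit] := Kind _ sSK'; first by rewrite imset_eq0.
have [rX | rX] := boolP (r \in X); last first.
  by exists (Sub r rX); rewrite card_del_hits SubK.
move: hit; have -> : val @: S :\: St r = set0.
  by apply/eqP; rewrite setD_eq0 (subset_trans sSK') ?sKX.
by rewrite cards0.
Qed.

(** Returning to [G] only adds rows to these columns, and the old rows still hit. *)
Lemma sb_independent_val (G : sgraph) (X : {set G}) (K : {set del X}) :
  sb_independent (@compl_col (del X)) K ->
  sb_independent (@compl_col G) (val @: K).
Proof.
move=> /sb_independentP Kind; apply/sb_independentP => S sSK S0.
have SE : S = val @: del_set X S.
  apply/setP => y; apply/idP/imsetP => [yS | [x]]; last by rewrite inE => xS ->.
  by have /imsetP[x _ yx] := subsetP sSK y yS; exists x; rewrite // inE -yx.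
have [||r hit] := Kind (del_set X S).
- apply/subsetP => x; rewrite inE => /(subsetP sSK)/imsetP[y yK].
  by move/val_inj->.
- by apply: contra_neq S0 => S0; rewrite SE S0 imset0.
by exists (val r); rewrite SE -card_del_hits.
Qed.

Lemma card_del_set (G : sgraph) (X K : {set G}) :
  [disjoint K & X] -> #|del_set X K| = #|K|.
Proof.
move=> dKX; rewrite -(card_imset _ (@val_inj _ _ {x : G | x \notin X})).
congr #|pred_of_set _|; apply/setP => y; apply/imsetP/idP => [[x]|yK].
  by rewrite inE => xK ->.
by exists (Sub y (negbT (disjointFr dKX yK))); rewrite // inE SubK.
Qed.

Lemma crk_ge_add2 (G : sgraph) (v w x : G) (K : {set G}) :
    x \in St v -> x \notin St w -> K \subset St v :&: St w ->
  sb_independent (@compl_col G) K -> #|K|.+2 <= crk G.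
Proof.
move=> xv xw; rewrite subsetI => /andP[sKv sKw] Kind.
have sxKv : x |: K \subset St v by rewrite subUset sub1set xv.
have vxK : v \notin x |: K.
  by apply/negP => /(subsetP sxKv); rewrite inE adj_irrefl.
have xK : x \notin K by apply: contra xw; apply: (subsetP sKw).
apply/leq_crk_on; exists (v |: (x |: K)); split; first exact: subsetT.
  (* Without loops, row [v] is 1 at its own column, so [v] serves as both row and new column. *)
  apply: (@sb_independentU1 _ _ v) sxKv _; first by rewrite adj_irrefl.
  by apply: (@sb_independentU1 _ _ w) sKw Kind; rewrite inE in xw.
by rewrite cardsU1 vxK cardsU1 xK.
Qed.

Theorem theorem3p10 (G : sgraph) (m : nat) (hm : 2 <= m) :
  m <= crk G <->
  exists v w : G,
    St v <> St w /\
    m - 2 <= crk_on (del_set [set v; w] (St v :&: St w)).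
Proof.
split=> [/leq_crk_on[K [_ Kind mK]] | [v [w [neq_vw /leq_crk_on]]]].
  have [|v [x [xK nvx sKv]]] := sb_independent_peel _ _ Kind.
    by rewrite -card_gt0 (leq_trans _ mK) // ltnW.
  have Lind := sb_independentS _ _ _ (subsetDl K [set x]) Kind.
  have cK : #|K| = #|K :\ x|.+1 by rewrite (cardsD1 x) xK.
  (* A second column is left to peel because [2 <= m]. *)
  have [|w [y [yL nwy sLw]]] := sb_independent_peel _ _ Lind.
    by rewrite -card_gt0 -ltnS -cK (leq_trans _ mK).
  have cL : #|K :\ x| = #|K :\ x :\ y|.+1 by rewrite (cardsD1 y) yL.
  have sMv : K :\ x :\ y \subset St v := subset_trans (subsetDl _ _) sKv.
  (* The second peeled column [y] separates the neighbourhoods: it survived the first peeling, so it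
     lies in [St v], but not in [St w]. *)
  exists v, w; split=> [vw | ].
    by have := subsetP sKv y yL; rewrite vw inE (negPf nwy).
  apply/leq_crk_on; exists (del_set [set v; w] (K :\ x :\ y)); split.
  - apply/subsetP => z; rewrite !(inE, in_set) => zM.
    by move: (subsetP sMv (val z)) (subsetP sLw (val z)); rewrite !inE zM => -> // ->.
  - apply: sb_independent_del_set; first by move=> z /set2P[] ->.
    exact: sb_independentS (subsetDl _ _) Lind.
  (* No column is lost in the deletion: the remaining set lies in [St v] and [St w], hence contains
     neither [v] nor [w]. *)
  rewrite card_del_set; first by rewrite leq_subLR add2n -cL -cK.
  rewrite disjoint_sym disjoint_subset; apply/subsetP => z /set2P[] ->.
    by apply/negP => /(subsetP sMv); rewrite inE adj_irrefl.
  by apply/negP => /(subsetP sLw); rewrite inE adj_irrefl.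
case=> K' [sKJ Kind mK].
have {}Kind := sb_independent_val _ _ _ Kind.
have sKI : val @: K' \subset St v :&: St w.
  by apply/subsetP => _ /imsetP[z /(subsetP sKJ) + ->]; rewrite inE.
rewrite leq_subLR add2n -(card_imset _ val_inj) in mK.
apply: leq_trans mK _.
(* Distinct neighbourhoods fail inclusion in some direction; the second case swaps [v] and [w]. *)
have [svw | /subsetPn[x xv xw]] := boolP (St v \subset St w); last first.
  exact: crk_ge_add2 xv xw sKI Kind.
have [swv | /subsetPn[x xw xv]] := boolP (St w \subset St v).
  by case: neq_vw; apply/eqP; rewrite eqEsubset svw.
by apply: crk_ge_add2 xw xv _ Kind; rewrite setIC.
Qed.
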